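(* Let $A$ be a countable-dimensional commutative domain over a field $\mathbb K$, let $D_1,D_2,\ldots$ be derivations of $A$, and let $Q(A)$ be the quotient field of $A$. Suppose that the differential center of $Q(A)$ is trivial, i.e. $\{f\in Q(A)\mid D_i f=0 \text{ for all } i\}=\mathbb K$. Then there exists a sequence $a_1,a_2,\ldots\in A\setminus\{0\}$ such that for each nonzero ideal $I$ of $A$ with $D_iI\subset I$ for all $i$ there is an $N$ such that $a_j\in I$ for all $j\ge N$.
   Context: A commutative domain over $\mathbb K$ is a commutative unital $\mathbb K$-algebra without zero divisors; countable-dimensional refers to its dimension as a $\mathbb K$-vector space. Derivations are $\mathbb K$-linear maps $D:A\to A$ satisfying the Leibniz rule; each $D_i$ is extended to $Q(A)$ by the quotient rule. *)

(* Defs.v *)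
From HB Require Import structures.
From mathcomp Require Import all_boot all_algebra.
From mathcomp Require Import classical_sets ring.

Set Implicit Arguments.
Unset Strict Implicit.
Unset Printing Implicit Defensive.

Import GRing.Theory.
Local Open Scope ring_scope.
Local Open Scope classical_set_scope.
Local Open Scope quotient_scope.

#[short(type="idomAlgType")]
HB.structure Definition IdomAlgebra (K : fieldType) :=
  {A of GRing.IntegralDomain A & GRing.Algebra K A}.

Notation "x %:F" := (FracField.tofrac x) : ring_scope.

Section Basis.
Variables (K : fieldType) (V : lmodType K).

Definition lin_indep (J : eqType) (b : J -> V) : Prop :=
  forall (s : seq J) (c : J -> K), uniq s ->
    \sum_(j <- s) c j *: b j = 0 -> forall j, j \in s -> c j = 0.

Definition spanning (J : eqType) (b : J -> V) : Prop :=
  forall v : V, exists (s : seq J) (c : J -> K), v = \sum_(j <- s) c j *: b j.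

(* A [countType] may be finite: "countable" means "at most countable". *)
Definition countable_dimensional : Prop :=
  exists (J : countType) (b : J -> V), lin_indep b /\ spanning b.

End Basis.

Definition leibniz (A : pzRingType) (D : A -> A) : Prop :=
  forall x y, D (x * y) = D x * y + x * D y.

(* The quotient rule, applied to the representative of [f] chosen by [repr];
   [frac_derE] shows that every other representative gives the same value. *)
Definition frac_der (A : idomainType) (D : A -> A) (f : {fraction A}) :
    {fraction A} :=
  let n := \n_(repr f) in let d := \d_(repr f) in
  (D n * d - n * D d)%:F / (d ^+ 2)%:F.

Lemma frac_repr (A : idomainType) (f : {fraction A}) :
  f = (\n_(repr f))%:F / (\d_(repr f))%:F.
Proof.
have d0 := denom_ratioP (repr f).
suff e : f * (\d_(repr f))%:F = (\n_(repr f))%:F.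
  by rewrite -e mulfK // tofrac_eq0.
rewrite -[X in X * _](reprK f); unlock FracField.tofrac.
rewrite -[LHS]FracField.pi_mul; apply/eqmodP; rewrite /= FracField.equivfE.
by rewrite /FracField.mulf !numden_Ratio ?oner_neq0 ?mulr1 ?mulf_neq0 // mulrC.
Qed.

Lemma frac_derE (A : idomainType) (D : A -> A) (n d : A) :
  leibniz D -> d != 0 ->
  frac_der D (n%:F / d%:F) = (D n * d - n * D d)%:F / (d ^+ 2)%:F.
Proof.
move=> DM d0; rewrite /frac_der; set f := n%:F / d%:F.
have e0 := denom_ratioP (repr f); move: (frac_repr f) e0.
move: (\n_(repr f)) (\d_(repr f)) => m e; rewrite /f => /eqP + e0.
rewrite eqr_div ?tofrac_eq0 // -!tofracM tofrac_eq => /eqP E.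
have := congr1 D E; rewrite !DM => ED.
apply/eqP; rewrite eqr_div ?tofrac_eq0 ?expf_neq0 // -!tofracM tofrac_eq.
apply/eqP/subr0_eq.
have -> : (D m * e - m * D e) * d ^+ 2 - (D n * d - n * D d) * e ^+ 2
  = (n * e - m * d) * (d * D e + e * D d)
    + d * e * ((D m * d + m * D d) - (D n * e + n * D e)) by ring.
by rewrite ED E !subrr mul0r mulr0 addr0.
Qed.

Definition diff_center (A : idomainType) (D : nat -> A -> A) :
    set {fraction A} :=
  [set f | forall i, frac_der (D i) f = 0].

(* Not necessarily proper: [setT] is an ideal. *)
Definition is_ideal (A : comPzRingType) (I : set A) : Prop :=
  [/\ I 0, forall x y, I x -> I y -> I (x + y) & forall a x, I x -> I (a * x)].

(* Main.v *)
Require Import Defs.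
From HB Require Import structures.
From mathcomp Require Import all_boot all_algebra.
From mathcomp Require Import classical_sets.
From mathcomp Require Import boolp ring.

Set Implicit Arguments.
Unset Strict Implicit.
Unset Printing Implicit Defensive.

Import GRing.Theory.
Local Open Scope ring_scope.
Local Open Scope classical_set_scope.

(** If [v_1, ..., v_n] in [A] are linearly independent over the field of
    constants [K], then some generalized Wronskian [W = det (theta_i v_j)], with
    [theta_i] compositions of the derivations, is nonzero.  If a differential
    ideal [I] contains [c_1 v_1 + ... + c_n v_n], it contains its images under
    all [theta_i], hence every [W c_j] by Cramer's rule, hence [W] itself unless
    all [c_j] vanish.  Taking for [a_n] such a Wronskian of the first [n] basis
    vectors gives the sequence. *)

Lemma is_ideal_sum (A : comPzRingType) (I : set A) (J : Type) (s : seq J)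
    (f : J -> A) : is_ideal I -> (forall j, I (f j)) -> I (\sum_(j <- s) f j).
Proof. by move=> [I0 ID _] If; apply: big_ind. Qed.

Lemma is_ideal0 (A : comPzRingType) : is_ideal [set 0 : A].
Proof.
by split=> //= [x y -> ->|a x ->]; rewrite ?addr0 ?mulr0.
Qed.

(** Multiplying by the adjugate recovers [\det M * x j] as an [A]-combination of the given elements
    of [I]. *)
Lemma is_ideal_Cramer (A : comNzRingType) (I : set A) (n : nat) (M : 'M[A]_n)
    (x : 'I_n -> A) : is_ideal I ->
  (forall i, I (\sum_j M i j * x j)) -> forall j, I (\det M * x j).
Proof.
move=> idI IM j; have [_ _ IZ] := idI.
have -> : \det M * x j = \sum_i \adj M j i * \sum_k M i k * x k.
  have := congr1 (fun N => (N *m (\col_k x k)) j 0) (mul_adj_mx M).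
  rewrite -mulmxA mul_scalar_mx !mxE => <-; apply: eq_bigr => i _.
  by rewrite !mxE; congr (_ * _); apply: eq_bigr => k _; rewrite !mxE.
by apply: is_ideal_sum => // i; apply: IZ.
Qed.

Section DifferentialWords.
Variables (K : fieldType) (A : idomAlgType K) (D : nat -> {linear A -> A}).

Definition der_word (w : seq nat) (x : A) : A := foldr (fun i => D i) x w.

Lemma der_word_sum n (w : seq nat) (c : 'I_n -> K) (v : 'I_n -> A) :
  der_word w (\sum_i c i *: v i) = \sum_i c i *: der_word w (v i).
Proof.
elim: w => //= i w ->; rewrite linear_sum.
by apply: eq_bigr => j _; rewrite linearZ.
Qed.

Lemma der_word_ideal (I : set A) (w : seq nat) (x : A) :
  (forall i, D i @` I `<=` I) -> I x -> I (der_word w x).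
Proof.
by move=> DI Ix; elim: w => //= i w IH; apply: (DI i); exists (der_word w x).
Qed.

Definition wronskian n (w : 'I_n -> seq nat) (v : 'I_n -> A) : A :=
  \det (\matrix_(i, j) der_word (w i) (v j)).

Definition free_family n (v : 'I_n -> A) : Prop :=
  forall c : 'I_n -> K, \sum_i c i *: v i = 0 -> forall i, c i = 0.

Hypothesis hD : forall i, leibniz (D i).
Hypothesis hcenter :
  diff_center D `<=` range (fun c : K => (c%:A : A)%:F).

Lemma constant_ratio (x y : A) : y != 0 ->
  (forall i, D i x * y - x * D i y = 0) -> exists c : K, x = c *: y.
Proof.
move=> y0 xy; have [i|c _ e] := hcenter (_ : diff_center D (x%:F / y%:F)).
  by rewrite frac_derE // xy tofrac0 mul0r.
exists c; apply/eqP; rewrite -mulr_algl -tofrac_eq tofracM e.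
by rewrite divfK // tofrac_eq0.
Qed.

(** Applying [D i] to the relation for [u] and subtracting the one for [i :: u] shows that the
    [D i (C j)] also annihilate every word. Eliminating the coordinate [ord0] between the two
    annihilators leaves a vector killed by a nonsingular matrix. *)
Lemma wronskian_annihilator_constant n (w : 'I_n -> seq nat)
    (v C : 'I_n.+1 -> A) :
  wronskian w (fun j => v (lift ord0 j)) != 0 ->
  (forall u, \sum_j C j * der_word u (v j) = 0) ->
  forall i j, D i (C j) * C ord0 - C j * D i (C ord0) = 0.
Proof.
move=> W0 Cv i j.
pose x j := D i (C j) * C ord0 - C j * D i (C ord0).
have x0 : x ord0 = 0 by rewrite /x mulrC subrr.
have xv u : \sum_j x (lift ord0 j) * der_word u (v (lift ord0 j)) = 0.
  have := congr1 (D i) (Cv u); rewrite linear_sum linear0.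
  under eq_bigr do rewrite hD.
  rewrite big_split /= [X in _ + X](Cv (i :: u)) addr0 => DC.
  have : \sum_j x j * der_word u (v j) = 0.
    transitivity (C ord0 * (\sum_j D i (C j) * der_word u (v j))
                - D i (C ord0) * \sum_j C j * der_word u (v j)).
      rewrite !mulr_sumr -sumrB; apply: eq_bigr => k _; rewrite /x; ring.
    by rewrite DC Cv !mulr0 subrr.
  by rewrite big_ord_recl x0 mul0r add0r.
have [k ->|-> //] := unliftP ord0 j.
(* Cramer's rule for the zero ideal. *)
have /eqP : wronskian w (fun j => v (lift ord0 j)) * x (lift ord0 k) = 0.
  apply: (is_ideal_Cramer (x := fun k => x (lift ord0 k)) (is_ideal0 A)) => l.
  by rewrite /= -[RHS](xv (w l)); apply: eq_bigr => m _; rewrite mxE mulrC.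
by rewrite mulf_eq0 (negPf W0) => /eqP.
Qed.

Lemma wronskian_neq0 n (v : 'I_n -> A) :
  free_family v -> exists w : 'I_n -> seq nat, wronskian w v != 0.
Proof.
elim: n v => [|n IH] v fv.
  by exists (fun=> [::]); rewrite /wronskian det_mx00 oner_neq0.
have [c sc i|w W0] := IH (fun j => v (lift ord0 j)).
  pose c' j := oapp c 0 (unlift ord0 j).
  have := fv c'; rewrite big_ord_recl /c' unlift_none scale0r add0r.
  under eq_bigr do rewrite liftK.
  by move=> /(_ sc (lift ord0 i)); rewrite liftK.
(* The word [u] becomes the new first row, above the rows given by [w]. *)
pose w' u i := oapp w u (unlift ord0 i).
(* The minors expanding [wronskian (w' u) v] along its first row do not
   involve [u], so if all these Wronskians vanish then the [C j] annihilate
   every [der_word u]. *)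
pose C j := cofactor (\matrix_(i, k) der_word (w' [::] i) (v k)) ord0 j.
apply: contrapT => /forallNP Wv.
have C0 : C ord0 != 0.
  rewrite /C /cofactor mul1r; move: W0; congr (\det _ != 0).
  by apply/matrixP=> i j; rewrite !mxE /w' liftK.
have Cv u : \sum_j C j * der_word u (v j) = 0.
  have /negP/negbNE/eqP Wu := Wv (w' u); rewrite -[RHS]Wu.
  rewrite /wronskian (expand_det_row _ ord0); apply: eq_bigr => j _.
  rewrite mxE /w' unlift_none mulrC; congr (_ * (_ * \det _)).
  by apply/matrixP=> i k; rewrite !mxE /w' liftK.
have /(_ _)/constant_ratio-/(_ _ C0) cst j :=
  fun i => wronskian_annihilator_constant W0 Cv i j.
have [c Cc] := choice cst.
(* Since [C j = c j *: C ord0], the annihilation relation for the empty word is [C ord0] times a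
   linear relation over [K]. *)
have /fv/(_ ord0) c0 : \sum_j c j *: v j = 0.
  apply: (mulfI C0); rewrite mulr0 -[RHS](Cv [::]) mulr_sumr.
  by apply: eq_bigr => j _; rewrite [in RHS]Cc -scalerAl scalerAr.
by move: C0; rewrite Cc c0 scale0r eqxx.
Qed.

Lemma wronskian_in_ideal (I : set A) n (w : 'I_n -> seq nat) (v : 'I_n -> A)
    (c : 'I_n -> K) :
  is_ideal I -> (forall i, D i @` I `<=` I) ->
  I (\sum_i c i *: v i) -> \sum_i c i *: v i != 0 -> I (wronskian w v).
Proof.
move=> idI DI Iv v0; have [_ _ IZ] := idI.
have /existsP[j cj] : [exists j, c j != 0].
  apply: contra_neqT v0 => /existsPn c0; rewrite big1 // => j _.
  by move/negbNE/eqP: (c0 j) => ->; rewrite scale0r.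
have /(IZ (c j)^-1%:A) : I (wronskian w v * (c j)%:A).
  apply: (is_ideal_Cramer (x := fun j => (c j)%:A) idI) => i.
  have := der_word_ideal (w i) DI Iv; rewrite der_word_sum.
  by congr I; apply: eq_bigr => k _; rewrite mxE mulr_algr.
by rewrite mulr_algr mulr_algl scalerA mulVf // scale1r.
Qed.

End DifferentialWords.

(** The list [s] may repeat indices, so the new coefficient at [i] adds up [c] over all occurrences
    of [i] in [s]; it is zero when there are none. *)
Lemma lincomb_widen (K : fieldType) (V : lmodType K) (J : eqType) (b : J -> V)
    (s t : seq J) (c : J -> K) : uniq t -> {subset s <= t} ->
  exists c' : J -> K, \sum_(j <- s) c j *: b j = \sum_(j <- t) c' j *: b j.
Proof.
move=> ut st; exists (fun i => \sum_(j <- s | j == i) c j).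
under [RHS]eq_bigr do rewrite scaler_suml big_mkcond.
rewrite exchange_big /= !big_seq; apply: eq_bigr => j /st jt.
rewrite (bigD1_seq j) //= eqxx big1 ?addr0 // => i.
by rewrite eq_sym => /negPf ->.
Qed.

Theorem theorem3 (K : fieldType) (A : idomAlgType K)
    (hA : countable_dimensional A)
    (D : nat -> {linear A -> A})
    (hD : forall i : nat, leibniz (D i))
    (hcenter : diff_center D = range (fun c : K => (c%:A : A)%:F)) :
  exists a : nat -> A,
    (forall j : nat, a j != 0) /\
    (forall I : set A, is_ideal I -> I <> [set 0] ->
       (forall i : nat, D i @` I `<=` I) ->
       exists N : nat, forall j : nat, (N <= j)%N -> I (a j)).
Proof.
have [J [b [ib sb]]] := hA.
(* The indices with code below [n]; codes that are not attained are skipped, so a finite [J] needs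
   no separate treatment. *)
pose t n : seq J := pmap (@pickle_inv J) (iota 0 n).
have ut n : uniq (t n) by apply: (pmap_uniq (@pickle_invK J)); apply: iota_uniq.
have mt n j : (pickle j < n)%N -> j \in t n.
  by move=> jn; rewrite mem_pmap -pickleK_inv map_f // mem_iota.
pose v n (i : 'I_(size (t n))) := b (tnth (in_tuple (t n)) i).
have fv n : free_family (v n).
  move=> c sc i.
  pose c' j := oapp c 0 (insub (index j (t n))).
  have c'E k : c' (tnth (in_tuple (t n)) k) = c k.
    rewrite /c' (tnth_nth (tnth (in_tuple (t n)) k)) index_uniq //=.
    by rewrite valK.
  rewrite -c'E; apply: (ib (t n) c') => //; last exact: mem_tnth.
  rewrite -[RHS]sc big_tnth; apply: eq_bigr => k _.
  by rewrite c'E.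
have hc : diff_center D `<=` range (fun c : K => (c%:A : A)%:F).
  by rewrite hcenter.
have /choice[a aW] n : exists x, exists2 w, x = wronskian D w (v n) & x != 0.
  by have [w W0] := wronskian_neq0 hD hc (fv n);
    exists (wronskian D w (v n)), w.
exists a; split=> [n|I idI I0 DI]; first by have [] := aW n.
have [x Ix x0] : exists2 x, I x & x != 0.
  apply: contrapT => nx; apply: I0; apply/seteqP; split=> [x Ix|x ->] /=.
    by apply/eqP; apply: contrapT => /negP x0; apply: nx; exists x.
  by case: idI.
have [s [c xE]] := sb x.
(* From this bound on, [t n] contains every index used to write [x]. *)
exists (\max_(j <- s) (pickle j).+1)%N => n sn.
have [j js|c' c'E] := lincomb_widen b c (ut n) (_ : {subset s <= t n}).
  by apply/mt/(leq_trans _ sn)/leq_bigmax_seq.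
pose d (i : 'I_(size (t n))) := c' (tnth (in_tuple (t n)) i).
have xv : x = \sum_i d i *: v n i by rewrite xE c'E big_tnth.
by have [w -> _] := aW n; apply: (wronskian_in_ideal w idI DI (c := d));
  rewrite -xv.
Qed.
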